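(* For each integer $n\ge1$, $$\mathrm{Ch}^{\mathrm{top}}_n=(-1)\sum_{M}\gamma^{\,n+1-|\mathcal{V}(M)|}\;\mathfrak{N}_M,$$ where the sum runs over all rooted, oriented, bicolored, connected maps $M$ with $n$ unlabeled edges.
   Context: **Young diagrams.** $\mathbb{N}=\{1,2,\dots\}$. $\mathbb{Y}$ is the set of all Young diagrams. A box of $\lambda$ is a pair $(x,y)\in\mathbb{N}^2$ with column index $x$ and row index $y$ (so $1\le x\le\lambda_y$). $A$ is an indeterminate and $\gamma:=-A+\frac1A\in\mathbb{Q}[A,A^{-1}]$. **Embeddings.** Let $G$ be a bicolored graph (bipartite graph with chosen coloring) with white vertices $\mathcal{V}_\circ(G)$ and black vertices $\mathcal{V}_\bullet(G)$, without isolated vertices. An embedding of $G$ into $\lambda\in\mathbb{Y}$ is a pair of functions $f_1\colon\mathcal{V}_\circ\to\mathbb{N}$, $f_2\colon\mathcal{V}_\bullet\to\mathbb{N}$ such that $(f_1(w),f_2(b))$ is a box of $\lambda$ for every white $w$ and black $b$ joined by an edge. $N_G(\lambda)$ is the number of embeddings, and $$\mathfrak{N}_G(\lambda):=A^{|\mathcal{V}_\circ(G)|}\left(-A^{-1}\right)^{|\mathcal{V}_\bullet(G)|}N_G(\lambda)\in\mathbb{Q}[A,A^{-1}].$$ $\mathfrak{S}(n)$ is the symmetric group on $[n]=\{1,\dots,n\}$ and $C(\sigma)$ is the set of cycles of $\sigma$ (including fixpoints). For $\sigma_1,\sigma_2\in\mathfrak{S}(n)$, $G(\sigma_1,\sigma_2)$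 is the bicolored graph with white vertices $C(\sigma_1)$, black vertices $C(\sigma_2)$, where two cycles are joined by an edge iff they are not disjoint; $\mathfrak{N}_{\sigma_1,\sigma_2}:=\mathfrak{N}_{G(\sigma_1,\sigma_2)}$. **The function $\mathrm{Ch}^{\mathrm{top}}_n\colon\mathbb{Y}\to\mathbb{Q}[A,A^{-1}]$.** $$\mathrm{Ch}^{\mathrm{top}}_n:=\frac{-1}{(n-1)!}\sum_{\substack{\sigma_1,\sigma_2\in\mathfrak{S}(n)\\ \langle\sigma_1,\sigma_2\rangle\text{ is transitive}}}\gamma^{\,n+1-|C(\sigma_1)|-|C(\sigma_2)|}\;\mathfrak{N}_{\sigma_1,\sigma_2},$$ where ''transitive'' means that the group generated by $\sigma_1,\sigma_2$ acts transitively on $[n]$. **Maps.** A labeled, oriented, bicolored, connected map with $n$ edges is identified with a pair $(\sigma_1,\sigma_2)\in\mathcal{X}_n:=\{(\sigma_1,\sigma_2)\in\mathfrak{S}(n)^2:\langle\sigma_1,\sigma_2\rangle\text{ is transitive}\}$: the edges are labeled by $[n]$, white vertices are the cycles of $\sigma_1$, black vertices are the cycles of $\sigma_2$ (the cycles giving the counterclockwise cyclic order of edges around the vertices). The group $\mathfrak{S}(n-1):=\{\pi\in\mathfrak{S}(n):\pi(n)=n\}$ acts on $\mathcal{X}_n$ by simultaneous conjugation $(\sigma_1,\sigma_2)\mapsto(\pi\sigma_1\pi^{-1},\pi\sigma_2\pi^{-1})$. A rooted, oriented, bicolored, connected map $M$ with $n$ unlabeled edges is an orbit of this action (the root edge is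 the one labeled $n$). For $M$ the orbit of $(\sigma_1,\sigma_2)$, its vertex set has cardinality $|\mathcal{V}(M)|=|C(\sigma_1)|+|C(\sigma_2)|$ and $\mathfrak{N}_M:=\mathfrak{N}_{\sigma_1,\sigma_2}$ (independent of the representative). *)

(* Defs.v *)
From HB Require Import structures.
From mathcomp Require Import all_boot all_order all_fingroup all_algebra.
From mathcomp Require Import finmap.
From mathcomp Require Import boolp classical_sets functions cardinality.

Set Implicit Arguments.
Unset Strict Implicit.
Unset Printing Implicit Defensive.

Import GRing.Theory.

(* The ring Q[A, A^-1], as the subring of the field Q(A) of the elements
   p / A^k with p a polynomial. *)

Section LaurentPolynomials.
Local Open Scope ring_scope.

Definition is_laurent : {pred {fraction {poly rat}}} :=
  fun x => `[< exists (p : {poly rat}) (k : nat),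
                 x = FracField.tofrac p / FracField.tofrac 'X ^+ k >].

Fact fracX_neq0 : FracField.tofrac ('X : {poly rat}) != 0.
Proof. by rewrite tofrac_eq0 polyX_eq0. Qed.

Fact is_laurent_subring_closed : subring_closed is_laurent.
Proof.
have Xn0 k : FracField.tofrac ('X : {poly rat}) ^+ k != 0.
  by rewrite expf_neq0 ?fracX_neq0.
split.
- by apply/asboolP; exists 1, 0%N; rewrite tofrac1 expr0 divr1.
- move=> _ _ /asboolP[p [k ->]] /asboolP[q [l ->]].
  apply/asboolP; exists (p * 'X^l - q * 'X^k), (k + l)%N.
  rewrite tofracB !tofracM !tofracXn exprD mulrBl invfM.
  by congr (_ - _); rewrite -?mulrA; congr (_ * _);
    [rewrite mulrCA divff ?mulr1 | rewrite mulrA divff ?mul1r].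
- move=> _ _ /asboolP[p [k ->]] /asboolP[q [l ->]].
  apply/asboolP; exists (p * q), (k + l)%N.
  by rewrite tofracM exprD invfM mulrACA.
Qed.

HB.instance Definition _ :=
  GRing.isSubringClosed.Build _ is_laurent is_laurent_subring_closed.

Record laurent : Type := Laurent {
  laurent_val : {fraction {poly rat}};
  laurent_valP : laurent_val \in is_laurent
}.

HB.instance Definition _ := [isSub for laurent_val].
HB.instance Definition _ := [Choice of laurent by <:].
HB.instance Definition _ := [SubChoice_isSubComNzRing of laurent by <:].

Fact laurentC_subproof (c : rat) : FracField.tofrac c%:P \in is_laurent.
Proof. by apply/asboolP; exists c%:P, 0%N; rewrite expr0 divr1. Qed.

Definition laurentC (c : rat) : laurent := Laurent (laurentC_subproof c).

Fact laurentA_subproof : FracField.tofrac 'X \in is_laurent.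
Proof. by apply/asboolP; exists 'X, 0%N; rewrite expr0 divr1. Qed.

Fact laurentAV_subproof : (FracField.tofrac 'X)^-1 \in is_laurent.
Proof. by apply/asboolP; exists 1, 1%N; rewrite tofrac1 expr1 div1r. Qed.

Definition laurentA : laurent := Laurent laurentA_subproof.
Definition laurentAV : laurent := Laurent laurentAV_subproof.

Fact laurentA_AV : laurentA * laurentAV = 1.
Proof. by apply: val_inj; rewrite rmorphM rmorph1 /= divff ?fracX_neq0. Qed.

Definition laurent_scale (c : rat) (x : laurent) : laurent := laurentC c * x.

Fact laurent_scaleA c d x :
  laurent_scale c (laurent_scale d x) = laurent_scale (c * d) x.
Proof. by apply: val_inj; rewrite !rmorphM /= polyCM tofracM mulrA. Qed.

Fact laurent_scale1 : left_id 1 laurent_scale.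
Proof. by move=> x; apply: val_inj; rewrite rmorphM /= tofrac1 mul1r. Qed.

Fact laurent_scaleDr : right_distributive laurent_scale +%R.
Proof. by move=> c x y; rewrite /laurent_scale mulrDr. Qed.

Fact laurent_scaleDl x : {morph laurent_scale^~ x : c d / c + d}.
Proof.
move=> c d; rewrite /laurent_scale -mulrDl; congr (_ * _).
by apply: val_inj; rewrite rmorphD /= polyCD tofracD.
Qed.

HB.instance Definition _ := GRing.Zmodule_isLmodule.Build rat laurent
  laurent_scaleA laurent_scale1 laurent_scaleDr laurent_scaleDl.

Fact laurent_scaleAl (c : rat) (x y : laurent) : c *: (x * y) = (c *: x) * y.
Proof. exact: mulrA. Qed.

HB.instance Definition _ :=
  GRing.Lmodule_isLalgebra.Build rat laurent laurent_scaleAl.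

Fact laurent_scaleAr (c : rat) (x y : laurent) : c *: (x * y) = x * (c *: y).
Proof. exact: mulrCA. Qed.

HB.instance Definition _ :=
  GRing.Lalgebra_isAlgebra.Build rat laurent laurent_scaleAr.

Definition gamma : laurent := - laurentA + laurentAV.

End LaurentPolynomials.

Definition is_young (s : seq nat) : bool := sorted geq s && (0 \notin s).

Record young : Type := Young { rows : seq nat; _ : is_young rows }.

(* Rows and columns are numbered from 1: lambda_y is nth 0 (rows la) y.-1. *)
Definition is_box (la : young) (x y : nat) : bool :=
  [&& 0 < x, 0 < y & x <= nth 0 (rows la) y.-1].

Record bicolored_graph : Type := BicoloredGraph {
  white : finType;
  black : finType;
  edge : white -> black -> bool;
  white_not_isolated : forall w, exists b, edge w b;
  black_not_isolated : forall b, exists w, edge w b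
}.

Definition embeddings (G : bicolored_graph) (la : young) :
    set ({ffun white G -> nat} * {ffun black G -> nat}) :=
  fun f => [/\ forall w, 0 < f.1 w,
               forall b, 0 < f.2 b &
               forall w b, edge w b -> is_box la (f.1 w) (f.2 b)].
Arguments embeddings : clear implicits.

(* fset_set sends an infinite set to the empty one; there are only finitely many
   embeddings because no vertex is isolated. *)
Definition nb_embeddings (G : bicolored_graph) (la : young) : nat :=
  #|` fset_set (embeddings G la)|%fset.

Definition frakN (G : bicolored_graph) (la : young) : laurent :=
  (laurentA ^+ #|white G| * (- laurentAV) ^+ #|black G|
   * (nb_embeddings G la)%:R)%R.

Section GraphOfPermutations.
Variables (n : nat) (s1 s2 : {perm 'I_n}).

(* The type of cycles C(s), each cycle being given by its support. *)
Definition cycles (s : {perm 'I_n}) : finType :=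
  {c : {set 'I_n} | c \in porbits s}.

Definition cycles_meet (c1 : cycles s1) (c2 : cycles s2) : bool :=
  ~~ [disjoint val c1 & val c2].

Fact cycles_meet_white c1 : exists c2, cycles_meet c1 c2.
Proof.
case: c1 => c1 Hc1; have /imsetP[x _ Ec1] := Hc1.
have Hc2 : porbit s2 x \in porbits s2 by exact: imset_f.
exists (Sub (porbit s2 x) Hc2 : cycles s2); apply/pred0Pn; exists x.
by rewrite /= Ec1 !porbit_id.
Qed.

Fact cycles_meet_black c2 : exists c1, cycles_meet c1 c2.
Proof.
case: c2 => c2 Hc2; have /imsetP[x _ Ec2] := Hc2.
have Hc1 : porbit s1 x \in porbits s1 by exact: imset_f.
exists (Sub (porbit s1 x) Hc1 : cycles s1); apply/pred0Pn; exists x.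
by rewrite /= Ec2 !porbit_id.
Qed.

Definition graph_of_perms : bicolored_graph :=
  BicoloredGraph cycles_meet_white cycles_meet_black.

End GraphOfPermutations.

Section Maps.
Variable n : nat.

Local Notation perm_pair := ({perm 'I_n} * {perm 'I_n})%type.

Definition labeled_maps : {set perm_pair} :=
  [set s : perm_pair |
     [transitive <<[set s.1; s.2]>>%g, on [set: 'I_n] | 'P]].

(* Permutations are multiplied from left to right, so that s ^ p = p^-1 * s * p
   is the composite of functions p o s o p^-1. *)
Definition conj_pair (s : perm_pair) (p : {perm 'I_n}) : perm_pair :=
  (s.1 ^ p, s.2 ^ p)%g.

Fact conj_pair1 : conj_pair^~ 1%g =1 id.
Proof. by case=> s1 s2; rewrite /conj_pair !conjg1. Qed.

Fact conj_pairM s : act_morph conj_pair s.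
Proof. by move=> p q; rewrite /conj_pair !conjgM. Qed.

Definition conj_pair_action : {action {perm 'I_n} &-> perm_pair} :=
  TotalAction conj_pair1 conj_pairM.

(* The label k of 1, ..., n is the ordinal of value k - 1: the last label n
   is the (for 0 < n, unique) i with i.+1 = n. *)
Definition fix_last : {set {perm 'I_n}} :=
  [set p : {perm 'I_n} | [forall i : 'I_n, (i.+1 == n) ==> (p i == i)]].

Definition rooted_maps : {set {set perm_pair}} :=
  [set orbit conj_pair_action fix_last s | s in labeled_maps].

(* A representative of an orbit (the default value is only used for set0). *)
Definition map_repr (M : {set perm_pair}) : perm_pair :=
  odflt (1%g, 1%g) [pick s in M].

Definition map_nb_vertices (M : {set perm_pair}) : nat :=
  #|cycles (map_repr M).1| + #|cycles (map_repr M).2|.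

Definition map_frakN (M : {set perm_pair}) (la : young) : laurent :=
  frakN (graph_of_perms (map_repr M).1 (map_repr M).2) la.

(* The exponent of gamma is a genuine natural number: the graph of a transitive
   pair is connected with n edges, hence has at most n + 1 vertices. *)
Definition Ch_top (la : young) : laurent :=
  ((- 1 / (n.-1)`!%:R : rat) *:
   \sum_(s in labeled_maps)
      gamma ^+ (n + 1 - #|cycles s.1| - #|cycles s.2|)
      * frakN (graph_of_perms s.1 s.2) la)%R.

End Maps.

(* Main.v *)
Require Import Defs.
From mathcomp Require Import finmap.
From mathcomp Require Import boolp classical_sets cardinality.
From mathcomp Require Import all_boot all_order all_fingroup all_algebra.

Set Implicit Arguments.
Unset Strict Implicit.
Unset Printing Implicit Defensive.

Import GRing.Theory Num.Theory.

(** A summand of [Ch_top] depends only on the isomorphism class of the graph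
    of the pair of permutations, hence is constant along simultaneous
    conjugation; grouping the labeled maps by rooted map therefore turns the
    sum over labeled maps into a sum over orbits weighted by their sizes.
    The point is that all orbits have the same size, (n-1)!, which cancels the
    prefactor: a relabeling that fixes the root edge and commutes with both
    permutations fixes every edge in the orbit of the root edge under the group
    they generate, which by transitivity is every edge. So the stabilizer of
    the root acts freely ([conj_pair_free], [card_rooted_map]); the constancy
    of the summand is [frakN_conj_pair] together with [card_cycles_conj]. *)

(** Two infinite sets satisfy the equality as well, since [fset_set] sends both
    of them to the empty set; this lets the number of embeddings be compared
    without a finiteness argument. *)
Lemma card_fset_set_eq (T U : choiceType) (A : set T) (B : set U) :
  (A #= B)%card -> #|` fset_set A|%fset = #|` fset_set B|%fset.
Proof.
move=> eqAB; have eq_fin := eq_finite_set eqAB.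
have [finA | infA] := pselect (finite_set A).
  by apply/fcard_eq => //; rewrite -eq_fin.
have infB : ~ finite_set B by rewrite -eq_fin.
by rewrite /fset_set; do 2!case: pselect => //; rewrite !cardfs0.
Qed.

(** Precomposition with a graph isomorphism is a bijection of embeddings. *)
Lemma nb_embeddings_iso (G H : bicolored_graph) (u : white G -> white H)
    (v : black G -> black H) (la : young) :
  bijective u -> bijective v -> (forall w b, edge (u w) (v b) = edge w b) ->
  nb_embeddings G la = nb_embeddings H la.
Proof.
move=> [u' uK u'K] [v' vK v'K] edge_uv; apply: card_fset_set_eq.
pose pullback (f : {ffun white H -> nat} * {ffun black H -> nat}) :=
  ([ffun w => f.1 (u w)], [ffun b => f.2 (v b)]).
have pullback_inj : injective pullback.
  move=> [f1 f2] [g1 g2] [/ffunP eq1 /ffunP eq2]; congr pair; apply/ffunP => x.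
    by have := eq1 (u' x); rewrite !ffunE u'K.
  by have := eq2 (v' x); rewrite !ffunE v'K.
suff <- : (pullback @` embeddings H la)%classic = embeddings G la.
  by apply: inj_card_eq => f g _ _; apply: pullback_inj.
apply/seteqP; split=> [_ [f [f1_gt0 f2_gt0 f_box] <-]|f [f1_gt0 f2_gt0 f_box]].
  split=> [w|b|w b Ewb]; rewrite !ffunE //.
  by apply: f_box; rewrite edge_uv.
exists ([ffun w => f.1 (u' w)], [ffun b => f.2 (v' b)]).
  split=> [w|b|w b Ewb]; rewrite !ffunE //.
  by apply: f_box; rewrite -edge_uv u'K v'K.
by case: f {f1_gt0 f2_gt0 f_box} => f1 f2; congr pair; apply/ffunP => x;
  rewrite !ffunE ?uK ?vK.
Qed.

(** If an element commuting with [p] sends [x] to [y], then [p] fixes both of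
    them or neither, so transitivity propagates a single fixed point. *)
Lemma commuting_transitive_perm1 (T : finType) (G : {group {perm T}})
    (p : {perm T}) (x : T) :
  [transitive G, on [set: T] | 'P] -> G \subset 'C[p]%g -> p x = x -> p = 1%g.
Proof.
move=> transG cGp px; apply/permP=> y; rewrite perm1.
have /imsetP[g Gg ->] : y \in orbit 'P G x by rewrite (atransP transG) ?inE.
have /cent1P cpg := subsetP cGp g Gg.
by rewrite /= /aperm -permM cpg permM px.
Qed.

Section Conjugation.
Variable n : nat.
Implicit Types (s p : {perm 'I_n}) (t : {perm 'I_n} * {perm 'I_n}).

Lemma porbit_conjg s p x : porbit (s ^ p)%g (p x) = p @: porbit s x.
Proof.
by rewrite !porbitE cycleJ -[p x]/('P%act x p) -setact_orbit.
Qed.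

Lemma porbits_conjg s p :
  porbits (s ^ p)%g = [set p @: c | c : {set _} in porbits s].
Proof.
apply/setP=> c; apply/imsetP/imsetP=> [[x _ ->]|[_ /imsetP[x _ ->] ->]].
  exists (porbit s (p^-1 x)%g); first exact: imset_f.
  by rewrite -porbit_conjg permKV.
by exists (p x); rewrite ?porbit_conjg.
Qed.

Fact cycle_conj_subproof s p (c : cycles s) : p @: val c \in porbits (s ^ p)%g.
Proof. by rewrite porbits_conjg imset_f ?(valP c). Qed.

Definition cycle_conj s p (c : cycles s) : cycles (s ^ p)%g :=
  Sub (p @: val c) (cycle_conj_subproof p c).

Lemma card_cycles_conj s p : #|cycles (s ^ p)%g| = #|cycles s|.
Proof.
rewrite !card_sig porbits_conjg card_imset //.
exact/imset_inj/perm_inj.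
Qed.

(** Injectivity suffices by equality of cardinals; an explicit inverse would
    have to be transported along [(s ^ p) ^ p^-1 = s], on which its type
    depends. *)
Lemma cycle_conj_bij s p : bijective (@cycle_conj s p).
Proof.
apply: inj_card_bij; last by rewrite card_cycles_conj.
by move=> c d /(congr1 val) /(imset_inj (@perm_inj _ p)) /val_inj.
Qed.

(** Taking images of cycles under [p] is an isomorphism of bicolored graphs,
    because [p], being injective, preserves disjointness. *)
Lemma frakN_conj_pair t p la :
  frakN (graph_of_perms (t.1 ^ p)%g (t.2 ^ p)%g) la
    = frakN (graph_of_perms t.1 t.2) la.
Proof.
rewrite /frakN /= !card_cycles_conj; congr (_ * _%:R)%R; apply/esym.
apply: (@nb_embeddings_iso (graph_of_perms t.1 t.2) (graph_of_perms _ _)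
  _ _ _ (cycle_conj_bij _ p) (cycle_conj_bij _ p)).
move=> w b; rewrite /= /cycles_meet /= -!setI_eq0 -imsetI ?imset_eq0 //.
by move=> x y _ _; apply: perm_inj.
Qed.

Lemma labeled_maps_conj t p :
  t \in labeled_maps n -> conj_pair t p \in labeled_maps n.
Proof.
rewrite !inE /= => transt.
have -> : [set (t.1 ^ p)%g; (t.2 ^ p)%g] = ([set t.1; t.2] :^ p)%g.
  by rewrite conjUg !conjg_set1.
case/imsetP: transt => x _ Ex; rewrite genJ; apply/imsetP.
exists ('P%act x p) => //.
by apply/esym/eqP; rewrite -setact_orbit -Ex eqEcard subsetT card_setact leqnn.
Qed.

(** This form carries both the group structure and the order of [fix_last]. *)
Lemma fix_lastE : fix_last n = Sym (~: [set i : 'I_n | i.+1 == n]).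
Proof.
rewrite SymE setCK; apply/setP=> p; rewrite inE.
apply/forallP/astabP => [fixp x|fixp i].
  by rewrite inE => last_x; apply/eqP; have := fixp x; rewrite last_x.
by apply/implyP => last_i; apply/eqP/fixp; rewrite inE.
Qed.

Lemma card_fix_last : #|fix_last n| = (n.-1)`!.
Proof.
rewrite fix_lastE card_Sym; congr (_`!); case: n => [|m].
  by apply/eqP; rewrite -leqn0 -[leqRHS](card_ord 0) max_card.
have -> : [set i : 'I_m.+1 | i.+1 == m.+1] = [set ord_max].
  by apply/setP=> i; rewrite !inE eqSS.
by rewrite cardsC1 card_ord.
Qed.

(** Rooted maps have no automorphisms: one commutes with both permutations,
    hence with the transitive group they generate, and fixes the root. *)
Lemma conj_pair_free t : 0 < n -> t \in labeled_maps n ->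
  'C_(fix_last n)[t | conj_pair_action n]%g = 1%g.
Proof.
move=> n_gt0; rewrite inE => transt.
rewrite fix_lastE; apply/trivgP/subsetP=> p /setIP[/=].
rewrite -fix_lastE => fixp /astab1P stabp.
have last_lt : n.-1 < n by rewrite prednK.
have plast : p (Ordinal last_lt) = Ordinal last_lt.
  by move: fixp; rewrite inE => /forallP/(_ (Ordinal last_lt));
     rewrite /= prednK // eqxx => /eqP.
rewrite inE; apply/eqP/(commuting_transitive_perm1 transt _ plast).
rewrite gen_subG; apply/subsetP=> g.
have [stab1 stab2] : (t.1 ^ p = t.1 /\ t.2 ^ p = t.2)%g.
  by move: stabp; case: (t) => t1 t2 [-> ->].
by case/set2P=> ->; apply/cent1P/commgP/conjg_fixP.
Qed.

(** Orbit-stabilizer for a free action. *)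
Lemma card_rooted_map M : 0 < n -> M \in rooted_maps n -> #|M| = (n.-1)`!.
Proof.
move=> n_gt0 /imsetP[t maps_t ->].
have := conj_pair_free n_gt0 maps_t; rewrite -card_fix_last fix_lastE => stab1.
by rewrite -(card_orbit_stab (conj_pair_action n) _ t) stab1 cards1 muln1.
Qed.

Lemma rooted_maps_partition : partition (rooted_maps n) (labeled_maps n).
Proof.
rewrite /rooted_maps fix_lastE; apply: orbit_partition.
apply/subsetP=> p _; rewrite !inE /=; apply/subsetP=> t maps_t.
by rewrite inE; apply: labeled_maps_conj.
Qed.

Lemma map_repr_conj M t : M \in rooted_maps n -> t \in M ->
  exists p, map_repr M = conj_pair t p.
Proof.
case/imsetP=> s _ ->; rewrite fix_lastE => orb_t.
rewrite /map_repr; case: pickP => [r|/(_ t)]; last by rewrite orb_t.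
rewrite /= -(orbit_eqP orb_t) => /imsetP[p _ ->].
by exists p.
Qed.

End Conjugation.

Theorem corollary1p8 (n : nat) (hn : (1 <= n)%N) (la : young) :
  Ch_top n la =
  ((-1) * \sum_(M in rooted_maps n)
            gamma ^+ (n + 1 - map_nb_vertices M) * map_frakN M la)%R.
Proof.
rewrite /Ch_top (set_partition_big _ (rooted_maps_partition n)) /=.
have weight M : M \in rooted_maps n ->
  (\sum_(t in M) gamma ^+ (n + 1 - #|cycles t.1| - #|cycles t.2|)
      * frakN (graph_of_perms t.1 t.2) la
   = (gamma ^+ (n + 1 - map_nb_vertices M) * map_frakN M la) *+ (n.-1)`!)%R.
  move=> MM; rewrite -(card_rooted_map hn MM) -sumr_const.
  apply: eq_bigr => t Mt; have [p reprE] := map_repr_conj MM Mt.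
  rewrite /map_nb_vertices /map_frakN reprE frakN_conj_pair.
  by rewrite !card_cycles_conj subnDA.
rewrite (eq_bigr _ weight) sumrMnl -scaler_nat scalerA divfK.
  by rewrite scaleN1r mulN1r.
by rewrite pnatr_eq0 -lt0n fact_gt0.
Qed.
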